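(* Assume that the density $f$ is bounded on $I$. Let $m\in\mathbb N\setminus\{0\}$. Then $$\begin{aligned}\mathbb E\left[\|\widehat b_{m}^{\prime,1}-b'\|_n^2\right]\leqslant{}& 3\|f\|_\infty\inf_{t\in\mathcal S_m}\|t-b'\|^2+3\,\mathbb E\left[\|\widehat\Phi_m'(\widehat\Phi_m^*\widehat\Phi_m)^{-1}\widehat\Phi_m^*\|_{\rm op}^2\,\|b-b_m\|_n^2\right]+3\|b_m'-(b')_m\|_f^2\\&+\frac{\sigma^2}{n}\mathbb E\left[{\rm Tr}\left((\widehat\Phi_m^*\widehat\Phi_m)^{-1}(\widehat\Phi_m')^*\widehat\Phi_m'\right)\right],\end{aligned}$$ where $b_m$ is the $\mathbb L^2(I,dx)$-orthogonal projection of $b$ on $\mathcal S_m$, $b_m'$ is the derivative of $b_m$, and $(b')_m$ is the $\mathbb L^2(I,dx)$-orthogonal projection of $b'$ on $\mathcal S_m$.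
   Context: Model: $Y_i=b(X_i)+\varepsilon_i$, $i=1,\dots,n$, where $b$ is an unknown continuously differentiable function, $X_1,\dots,X_n$ are i.i.d. real random variables with density $f$ with respect to Lebesgue measure, and $\varepsilon_1,\dots,\varepsilon_n$ are i.i.d., centered, with variance $\sigma^2$, and independent of $X_1,\dots,X_n$. $I\subseteq\mathbb R$ is an interval and $(\varphi_j)_{j\geqslant 1}$ is a Hilbert (orthonormal) basis of $\mathbb L^2(I,dx)$ made of differentiable functions, extended by $0$ outside $I$. $\mathcal S_m={\rm span}\{\varphi_1,\dots,\varphi_m\}$. Estimation takes place on $I$: $b$ and $b'$ stand for $b\mathbf 1_I$ and $b'\mathbf 1_I$, and $b,b'$ are square integrable on $I$. Norms: $\|\cdot\|$ is the norm of $\mathbb L^2(I,dx)$; $\|\psi\|_f^2=\int_I\psi(x)^2f(x)dx$; $\|\psi\|_n^2=\frac1n\sum_{i=1}^n\psi(X_i)^2$; $\|f\|_\infty=\sup_I f$; $\|M\|_{\rm op}^2=\lambda_{\max}(MM^* )$, with $M^*$ the transpose of $M$. Matrices: $\widehat\Phi_m=(\varphi_j(X_i))_{1\leqslant i\leqslant n,1\leqslant j\leqslant m}$, $\widehat\Phi_m'=(\varphi_j'(X_i))_{1\leqslant i\leqslant n,1\leqslant j\leqslant m}$, $\widehat\Psi_m=\frac1n\widehat\Phi_m^*\widehat\Phi_m$ (assumed almost surely invertible), $\mathbf Y=(Y_1,\dots,Y_n)^*$. Estimator: $\widehat b_m^{\prime,1}(x)=\sum_{j=1}^m[\widehat\theta_m^1]_j\varphi_j'(x)$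 with $\widehat\theta_m^1=\frac1n\widehat\Psi_m^{-1}\widehat\Phi_m^*\mathbf Y$ (the derivative of the least-squares projection estimator of $b$). *)

(* Defs.v *)
From HB Require Import structures.
From mathcomp Require Export all_boot all_order all_algebra.
From mathcomp Require Export all_classical all_reals all_analysis.

Set Implicit Arguments.
Unset Strict Implicit.
Unset Printing Implicit Defensive.

Import Order.TTheory GRing.Theory Num.Theory.
Export numFieldNormedType.Exports.

Local Open Scope classical_set_scope.
Local Open Scope ring_scope.

Section L2.
Context {R : realType}.
Implicit Types (I : interval R) (g h t : R -> R) (phi : nat -> R -> R).

(* Squared norm of L^2(I, dx); extended-valued, as g need not be in L^2. *)
Definition sqnormL2 I g : \bar R :=
  (\int[lebesgue_measure]_(x in [set` I]) ((g x) ^+ 2)%:E)%E.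

Definition sqnormL2w I (f : R -> R) g : \bar R :=
  (\int[lebesgue_measure]_(x in [set` I]) ((g x) ^+ 2 * f x)%:E)%E.

Definition inL2 I g : Prop :=
  measurable_fun [set` I] g /\ (sqnormL2 I g < +oo)%E.

Definition dotL2 I g h : R :=
  \int[lebesgue_measure]_(x in [set` I]) (g x * h x).

(* The space S_m; the basis is indexed from 0, so that the first m vectors are
   phi 0, ..., phi (m - 1). *)
Definition spanS phi (m : nat) : set (R -> R) :=
  [set t | exists a : 'I_m -> R, t = fun x => \sum_(j < m) a j * phi j x].

Record hilbert_basis I phi : Prop := HilbertBasis {
  hilbert_basis_inL2 : forall j, inL2 I (phi j) ;
  hilbert_basis_orthonormal :
    forall j k, dotL2 I (phi j) (phi k) = (j == k)%:R ;
  hilbert_basis_dense : forall g, inL2 I g -> forall e : R, 0 < e ->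
    exists m t, spanS phi m t /\ (sqnormL2 I (g \- t)%R < (e ^+ 2)%:E)%E }.

Definition is_orthproj I phi (m : nat) g t : Prop :=
  spanS phi m t /\ forall s, spanS phi m s -> dotL2 I (g \- t)%R s = 0.

(* The derivative is taken within I (one-sided at an endpoint belonging to I):
   a function extended by 0 outside I may jump at the endpoints. *)
Definition diff_quotient g (x y : R) : R := (g y - g x) / (y - x).

Definition differentiable_on I g : Prop :=
  forall x, x \in I -> cvg (diff_quotient g x y @[y --> within [set` I] x^']).

Definition deriv_in I g (x : R) : R :=
  if x \in I then lim (diff_quotient g x y @[y --> within [set` I] x^'])
  else 0.

End L2.

Section matrices.
Context {R : realType}.

Definition lambda_max n (A : 'M[R]_n) : R := sup [set a | eigenvalue A a].

Definition sqopnorm n p (M : 'M[R]_(n, p)) : R := lambda_max (M *m M^T).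

Definition sqnorm_emp n (x : 'I_n -> R) (psi : R -> R) : R :=
  n%:R^-1 * \sum_(i < n) (psi (x i)) ^+ 2.

Definition design n (m : nat) (g : nat -> R -> R) (x : 'I_n -> R) :
    'M[R]_(n, m) :=
  \matrix_(i < n, j < m) g j (x i).

Definition Psihat n m (phi : nat -> R -> R) (x : 'I_n -> R) : 'M[R]_m :=
  n%:R^-1 *: ((design m phi x)^T *m design m phi x).

Definition thetahat n m (phi : nat -> R -> R) (x y : 'I_n -> R) : 'cV[R]_m :=
  n%:R^-1 *: (invmx (Psihat m phi x) *m (design m phi x)^T *m \col_i y i).

Definition bhat' n (I : interval R) m (phi : nat -> R -> R) (x y : 'I_n -> R)
    (u : R) : R :=
  \sum_(j < m) thetahat m phi x y j 0 * deriv_in I (phi j) u.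

End matrices.

Section independence.
Context d {T : measurableType d} {R : realType} (P : probability T R).

Definition mutually_independent n (Z : 'I_n -> {RV P >-> R}) : Prop :=
  forall (J : {set 'I_n}) (B : 'I_n -> set R), (forall i, measurable (B i)) ->
    P (\bigcap_(i in [set` J]) (Z i @^-1` B i)) =
    (\prod_(i in J) P (Z i @^-1` B i))%E.

(* Independence of the random vectors Z and W, that is, of the sigma-algebras
   that they generate. *)
Definition independent_vectors n p
    (Z : 'I_n -> {RV P >-> R}) (W : 'I_p -> {RV P >-> R}) : Prop :=
  forall A B : set T,
    g_sigma_preimage (fun i => Z i : T -> R) A ->
    g_sigma_preimage (fun i => W i : T -> R) B ->
    P (A `&` B) = (P A * P B)%E.

Definition identically_distributed n (Z : 'I_n -> {RV P >-> R}) : Prop :=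
  forall i j (B : set R), measurable B ->
    distribution P (Z i) B = distribution P (Z j) B.

Definition has_density (Z : {RV P >-> R}) (f : R -> R) : Prop :=
  [/\ measurable_fun setT f, forall x, 0 <= f x &
      forall B : set R, measurable B ->
        distribution P Z B = (\int[lebesgue_measure]_(x in B) (f x)%:E)%E].

End independence.

(* Main.v *)
Require Import Defs.
From mathcomp Require Import all_boot all_order all_algebra.
From mathcomp Require Import all_classical all_reals all_analysis.
From mathcomp Require Import measurable_realfun ring lra.

(** Write [G = Phi^T Phi], [H = Phi' G^-1 Phi^T] and [u(X)] for the vector of the
[u(X_i)]. Since [Phi] vanishes on the rows with [X_i] outside [I], the vector of
the values of the estimator at the [X_i] is [H (b 1_I)(X) + H eps]; as
[H b_m(X) = b_m'(X)], the error at the observations is [B(X) + H eps] with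
[B = H (b - b_m)(X) + (b_m' - (b')_m)(X) + ((b')_m - b')(X)].
The noise is centered, uncorrelated and independent of [X], so the mean square
of [B + H eps] is that of [B] plus [sigma^2 E |H|_F^2], and
[|H|_F^2 = tr (G^-1 Phi'^T Phi')]. The three terms of [B] are separated by
[|u + v + w|^2 <= 3 (|u|^2 + |v|^2 + |w|^2)]: the first is bounded by the
operator norm, the other two have empirical norms of expectation [|.|_f^2], and
[(b')_m] is the best approximation of [b'] in [S_m]. *)

Set Implicit Arguments.
Unset Strict Implicit.
Unset Printing Implicit Defensive.

Import Order.TTheory GRing.Theory Num.Theory.
Import numFieldNormedType.Exports.

Local Open Scope classical_set_scope.
Local Open Scope ring_scope.

(** * Rayleigh quotients and the operator norm *)

(** Neither the bias nor [H] is known to be square integrable, so every expectation may be infinite.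
    Signal and noise are therefore separated by an inequality in [\bar R], trivial when its
    right-hand side is [+oo]. This is done before the triangle inequality is applied, which is why
    the factor 3 falls on the bias only. Independence is a statement about sigma-algebras: [H] and
    the bias have to be measurable for the one generated by the [X_i], which calls for an explicit
    treatment of [invmx] and of the derivative within [I]. The operator norm is a supremum of real
    eigenvalues. For it to control [|M u|], the supremum of the Rayleigh quotients of [M M^T] has to
    be shown to be an eigenvalue. Its expectation enters only through the monotonicity of the
    integral of nonnegative functions, which holds without measurability. *)

Section linear_algebra.
Context {R : realType}.

Definition dotc n (x y : 'cV[R]_n) : R := \sum_i x i 0 * y i 0.

Lemma dotcE n (x y : 'cV[R]_n) : dotc x y = (x^T *m y) 0 0.
Proof. by rewrite mxE; apply: eq_bigr => i _; rewrite mxE. Qed.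

Lemma dotcC n (x y : 'cV[R]_n) : dotc x y = dotc y x.
Proof. by apply: eq_bigr => i _; rewrite mulrC. Qed.

Lemma dotcDr n (x y z : 'cV[R]_n) : dotc x (y + z) = dotc x y + dotc x z.
Proof. by rewrite -big_split; apply: eq_bigr => i _; rewrite mxE mulrDr. Qed.

Lemma dotcZr n a (x y : 'cV[R]_n) : dotc x (a *: y) = a * dotc x y.
Proof. by rewrite mulr_sumr; apply: eq_bigr => i _; rewrite mxE mulrCA. Qed.

Lemma dotcBr n (x y z : 'cV[R]_n) : dotc x (y - z) = dotc x y - dotc x z.
Proof. by rewrite dotcDr -scaleN1r dotcZr mulN1r. Qed.

Lemma dotcMr n p (A : 'M[R]_(n, p)) (x : 'cV[R]_n) (y : 'cV[R]_p) :
  dotc x (A *m y) = dotc (A^T *m x) y.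
Proof. by rewrite !dotcE trmx_mul trmxK mulmxA. Qed.

Lemma dotc_ge0 n (x : 'cV[R]_n) : 0 <= dotc x x.
Proof. by apply: sumr_ge0 => i _; rewrite -expr2 sqr_ge0. Qed.

Lemma dotc_eq0 n (x : 'cV[R]_n) : (dotc x x == 0) = (x == 0).
Proof.
rewrite psumr_eq0; last by move=> i _; rewrite -expr2 sqr_ge0.
apply/allP/eqP => [x0|-> i _]; last by rewrite mxE mul0r eqxx.
apply/matrixP => i j; rewrite ord1 mxE; apply/eqP.
by have := x0 i (mem_index_enum _); rewrite /= mulf_eq0 orbb.
Qed.


Lemma dotc_cauchy_schwarz n (x y : 'cV[R]_n) :
  dotc x y ^+ 2 <= dotc x x * dotc y y.
Proof.
have [/eqP|y0] := eqVneq (dotc y y) 0.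
  rewrite dotc_eq0 => /eqP ->.
  have d0 (z : 'cV[R]_n) : dotc z 0 = 0.
    by rewrite /dotc big1// => i _; rewrite mxE mulr0.
  by rewrite !d0 expr0n mulr0.
have ypos : 0 < dotc y y by rewrite lt_neqAle eq_sym y0 dotc_ge0.
(* The square of this vector is [y.y * (x.x * y.y - (x.y)^2)], and [y.y > 0]. *)
have := dotc_ge0 (dotc y y *: x - dotc x y *: y).
rewrite dotcBr !dotcZr ![dotc (_ - _) _]dotcC !dotcBr !dotcZr (dotcC y x).
rewrite -[_ <= _ * _]subr_ge0 -(pmulr_rge0 (_ - _ ^+ 2) ypos).
by congr (0 <= _); ring.
Qed.

(** Cauchy-Schwarz on each row gives the squared Frobenius norm as a bound; adding 1 keeps the
    constant positive when [A = 0]. *)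
Lemma mulmx_dotc_bounded n p (A : 'M[R]_(n, p)) :
  exists2 K, 0 < K & forall x, dotc (A *m x) (A *m x) <= K * dotc x x.
Proof.
pose K := \sum_i dotc (row i A)^T (row i A)^T.
have K0 : 0 <= K by apply: sumr_ge0 => i _; exact: dotc_ge0.
exists (1 + K) => [|x]; first by rewrite ltr_pwDl.
rewrite (@le_trans _ _ (K * dotc x x))//; last first.
  by rewrite ler_wpM2r ?dotc_ge0// lerDr.
rewrite mulr_suml ler_sum// => i _.
rewrite -expr2 (le_trans _ (dotc_cauchy_schwarz _ _))//.
by rewrite mxE /dotc; under [in leRHS]eq_bigr do rewrite !mxE.
Qed.

(* Let [s] be the supremum of the Rayleigh quotients. If [D = s - B] were
   invertible, positivity of [D] at [x - (K + 1)^-1 D x] would bound the form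
   of [D] below by a multiple of the squared norm, and the quotients would stay
   away from [s]. *)
Lemma rayleigh_eigenvalue n (B : 'M[R]_n) : (0 < n)%N -> B^T = B ->
  exists2 s, eigenvalue B s & forall x, dotc x (B *m x) <= s * dotc x x.
Proof.
move=> n0 Bsym.
have [C C0 BC] := mulmx_dotc_bounded B.
(* From [2 x.Bx <= x.x + Bx.Bx], the expansion of [|x - B x|^2 >= 0]. *)
have BC' x : dotc x (B *m x) <= (C + 1) * dotc x x.
  have := dotc_ge0 (x - B *m x).
  rewrite dotcBr ![dotc (_ - _) _]dotcC !dotcBr (dotcC (B *m x) x).
  have := BC x; have := dotc_ge0 x; have := dotc_ge0 (B *m x); nra.
pose Q := [set dotc x (B *m x) | x in [set x | dotc x x = 1]].
pose e : 'cV[R]_n := delta_mx (Ordinal n0) 0.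
have e1 : dotc e e = 1.
  rewrite /dotc (bigD1 (Ordinal n0))//= big1 ?addr0 => [|i /negPf ni].
    by rewrite !mxE !eqxx mulr1.
  by rewrite !mxE ni mul0r.
have supQ : has_sup Q.
  split; first by exists (dotc e (B *m e)), e.
  by exists (C + 1) => _ [x /= x1 <-]; rewrite (le_trans (BC' x))// x1 mulr1.
pose s := sup Q.
have sP x : dotc x (B *m x) <= s * dotc x x.
  have [/eqP|x0] := eqVneq (dotc x x) 0.
    rewrite dotc_eq0 => /eqP ->; rewrite mulmx0 /dotc !big1 ?mulr0// => i _.
    by rewrite mxE mulr0.
  have xpos : 0 < dotc x x by rewrite lt_neqAle eq_sym x0 dotc_ge0.
  pose r := Num.sqrt (dotc x x).
  have r2 : r ^+ 2 = dotc x x by rewrite sqr_sqrtr// ltW.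
  have r0 : r != 0 by rewrite -sqrf_eq0 r2.
  have := ub_le_sup supQ.2 (x := dotc (r^-1 *: x) (B *m (r^-1 *: x))).
  rewrite -scalemxAr !dotcZr ![dotc (_ *: _) _]dotcC !dotcZr -/s => h.
  rewrite -r2 -ler_pdivrMr ?exprn_gt0 ?lt_neqAle 1?eq_sym ?r0 ?sqrtr_ge0//.
  rewrite (le_trans _ (h _))//.
    by rewrite dotcC le_eqVlt; apply/orP; left; apply/eqP; field.
  exists (r^-1 *: x) => /=.
    by rewrite dotcZr dotcC dotcZr -r2; field.
  by rewrite -scalemxAr !dotcZr ![dotc (_ *: _) _]dotcC !dotcZr.
exists s => //; apply: contraT => sN.
pose D := s%:M - B.
have Dsym : D^T = D by rewrite /D linearB/= tr_scalar_mx Bsym.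
have qD x : dotc x (D *m x) = s * dotc x x - dotc x (B *m x).
  by rewrite mulmxBl mul_scalar_mx dotcBr dotcZr.
(* [eigenspace B s] is the left kernel of [B - s]; it is trivial exactly when [B - s = - D] is
   invertible. *)
have Du : D \in unitmx.
  rewrite -row_free_unit -kermx_eq0; move: sN; rewrite negbK /eigenspace.
  rewrite !kermx_eq0 !row_free_unit /D -opprB.
  by rewrite -scaleN1r unitmxZ// unitrN1.
have [K K0 DK] := mulmx_dotc_bounded D.
have [L L0 EL] := mulmx_dotc_bounded (invmx D).
have DKq x : dotc x (D *m x) <= (K + 1) * dotc x x.
  have := dotc_ge0 (x - D *m x).
  rewrite dotcBr ![dotc (_ - _) _]dotcC !dotcBr (dotcC (D *m x) x).
  have := DK x; have := dotc_ge0 x; have := dotc_ge0 (D *m x); nra.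
have K1 : 0 < K + 1 by rewrite addr_gt0.
have DDq x : dotc (D *m x) (D *m x) <= (K + 1) * dotc x (D *m x).
  have : 0 <= dotc (x - (K + 1)^-1 *: (D *m x))
                   (D *m (x - (K + 1)^-1 *: (D *m x))).
    by rewrite qD subr_ge0.
  rewrite mulmxBr -scalemxAr !dotcBr !dotcZr ![dotc (_ - _) _]dotcC !dotcBr.
  have c1 : dotc (D *m x) x = dotc x (D *m x) by exact: dotcC.
  have c2 : dotc (D *m (D *m x)) x = dotc (D *m x) (D *m x).
    by rewrite dotcC dotcMr Dsym.
  have c3 : dotc (D *m (D *m x)) (D *m x) = dotc (D *m x) (D *m (D *m x)).
    exact: dotcC.
  rewrite !dotcZr c1 c2 c3 => h.
  (* By [DKq] at [D x], the quadratic term of [h] is at most [(K + 1)^-1 |D x|^2], which absorbs one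
     of the two equal cross terms. *)
  have : 0 <= dotc x (D *m x) - (K + 1)^-1 * dotc (D *m x) (D *m x).
    have h2 := DKq (D *m x).
    apply: le_trans h _; rewrite -subr_ge0.
    rewrite [X in 0 <= X](_ : _ = (K + 1)^-1 ^+ 2 *
      ((K + 1) * dotc (D *m x) (D *m x) - dotc (D *m x) (D *m (D *m x)))).
      by rewrite mulr_ge0 ?sqr_ge0// subr_ge0.
    by field; rewrite gt_eqF.
  by rewrite subr_ge0 mulrC ler_pdivrMr// mulrC.
have Dlow x : dotc x x <= L * (K + 1) * dotc x (D *m x).
  rewrite -{1 2}(mulKmx Du x) (le_trans (EL _))// -mulrA.
  by rewrite ler_wpM2l ?DDq// ltW.
have LK : 0 < L * (K + 1) by rewrite mulr_gt0.
have : s <= s - (L * (K + 1))^-1.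
  apply: ge_sup; first exact: supQ.1.
  move=> _ [x /= x1 <-]; have := Dlow x; rewrite qD x1 mulr1 => h.
  by rewrite lerBrDr -lerBrDl -div1r ler_pdivrMr// mulrC.
by rewrite lerBrDr gerDl leNgt invr_gt0 LK.
Qed.

(** [eigenvalue] refers to row vectors acting on the left; as [M M^T] is symmetric, transposing
    yields a column eigenvector [x], and [x.(M M^T x) = |M^T x|^2]. *)
Lemma eigenvalue_trmulP n p (M : 'M[R]_(n, p)) a :
  eigenvalue (M *m M^T) a ->
  exists2 x, 0 < dotc x x & dotc (M^T *m x) (M^T *m x) = a * dotc x x.
Proof.
move=> /eigenvalueP[v vM v0]; exists v^T.
  by rewrite lt_neqAle dotc_ge0 eq_sym dotc_eq0 trmx_eq0 v0.
have MMv : M *m (M^T *m v^T) = a *: v^T.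
  by rewrite -linearZ/= -vM !trmx_mul trmxK mulmxA.
by rewrite dotcMr trmxK MMv dotcC dotcZr.
Qed.

(** Without an upper bound, the [sup] in [lambda_max] would be a default value. *)
Lemma eigenvalue_trmul_bounded n p (M : 'M[R]_(n, p)) :
  has_ubound [set a | eigenvalue (M *m M^T) a].
Proof.
have [C C0 BC] := mulmx_dotc_bounded M^T.
exists C => a /eigenvalue_trmulP[x xpos xa].
by have := BC x; rewrite xa ler_pM2r.
Qed.

Lemma eigenvalue_trmul_ge0 n p (M : 'M[R]_(n, p)) a :
  eigenvalue (M *m M^T) a -> 0 <= a.
Proof.
move=> /eigenvalue_trmulP[x xpos xa].
by rewrite -(pmulr_lge0 _ xpos) -xa dotc_ge0.
Qed.

Lemma eigenvalue_trmul_exists n p (M : 'M[R]_(n, p)) : (0 < n)%N ->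
  exists2 s, eigenvalue (M *m M^T) s &
    forall x, dotc x (M *m M^T *m x) <= s * dotc x x.
Proof. by move=> n0; apply: rayleigh_eigenvalue; rewrite // trmx_mul trmxK. Qed.

Lemma sqopnorm_ge0 n p (M : 'M[R]_(n, p)) : (0 < n)%N -> 0 <= sqopnorm M.
Proof.
move=> n0; have [s es _] := eigenvalue_trmul_exists M n0.
apply: le_trans (eigenvalue_trmul_ge0 es) _.
by apply: ub_le_sup es; exact: eigenvalue_trmul_bounded.
Qed.

(** The eigenvalues of [M M^T] control [M^T], not [M]. Duality passes from one to the other: with
    [z = M u], [|z|^4 = (M^T z . u)^2 <= |M^T z|^2 |u|^2 <= sqopnorm M |z|^2 |u|^2], and [|z|^2] is
    divided out. *)
Lemma sqopnormP n p (M : 'M[R]_(n, p)) (u : 'cV[R]_p) : (0 < n)%N ->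
  dotc (M *m u) (M *m u) <= sqopnorm M * dotc u u.
Proof.
move=> n0; have [s es sP] := eigenvalue_trmul_exists M n0.
have sl : s <= sqopnorm M by apply: ub_le_sup es; exact: eigenvalue_trmul_bounded.
set z := M *m u.
have zl : dotc (M^T *m z) (M^T *m z) <= sqopnorm M * dotc z z.
  rewrite dotcMr trmxK mulmxA dotcC (le_trans (sP _))//.
  by rewrite ler_wpM2r// dotc_ge0.
have [->|z0] := eqVneq (dotc z z) 0.
  by rewrite mulr_ge0 ?dotc_ge0 ?sqopnorm_ge0.
have zpos : 0 < dotc z z by rewrite lt_neqAle eq_sym z0 dotc_ge0.
have cs := dotc_cauchy_schwarz (M^T *m z) u; rewrite -dotcMr -/z in cs.
rewrite -(ler_pM2l zpos) -expr2 (le_trans cs)//.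
by rewrite mulrA (mulrC (dotc z z)) ler_wpM2r ?dotc_ge0.
Qed.

(** The squared Frobenius norm is [tr (M M^T)]; there [Phi^T Phi] cancels one of the two inverses,
    and the trace is cyclic. *)
Lemma sum_sqr_trace n m (Phi Phi' : 'M[R]_(n, m)) : Phi^T *m Phi \in unitmx ->
  let M := Phi' *m invmx (Phi^T *m Phi) *m Phi^T in
  \sum_i \sum_k M i k ^+ 2 = \tr (invmx (Phi^T *m Phi) *m (Phi'^T *m Phi')).
Proof.
move=> u M.
transitivity (\tr (M *m M^T)).
  rewrite /mxtrace; apply: eq_bigr => i _; rewrite mxE.
  by apply: eq_bigr => k _; rewrite !mxE expr2.
rewrite !trmx_mul trmxK trmx_inv trmx_mul trmxK -!mulmxA.
by rewrite (mulmxA Phi^T Phi) (mulKVmx u) mxtrace_mulC -mulmxA.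
Qed.

(** Here [a] and [a'] are the coordinates of the projections of [b] and [b']. [Y] and [bX + e] are
    compared only after [Phi^T], since they may differ at observations outside [I]. *)
Lemma fitted_decomposition n m (Phi Phi' : 'M[R]_(n, m)) (Y e bX dbX : 'cV[R]_n)
    (a a' : 'cV[R]_m) : Phi^T *m Phi \in unitmx ->
  Phi^T *m Y = Phi^T *m (bX + e) ->
  let M := Phi' *m invmx (Phi^T *m Phi) *m Phi^T in
  Phi' *m (invmx (Phi^T *m Phi) *m Phi^T *m Y) - dbX =
  M *m (bX - Phi *m a) + (Phi' *m a - Phi *m a') + (Phi *m a' - dbX) + M *m e.
Proof.
move=> u YE M.
rewrite -(mulmxA _ Phi^T) YE !mulmxA -/M mulmxDr mulmxBr.
have -> : M *m (Phi *m a) = Phi' *m a.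
  by rewrite /M !mulmxA -(mulmxA _ Phi^T) mulmxKV.
rewrite -!addrA; congr (_ + _); rewrite [RHS]addrA addNr add0r.
by rewrite addrA addNr add0r addrC.
Qed.
End linear_algebra.

(** * Measurability of matrix operations and of derivatives within an interval *)

Section real_measurability.
Context d (T : measurableType d) (R : realType).

(** Writing [1/y] as [y (y^2)^-1] makes the inverse a real power of a nonnegative number, measurable
    on the whole line; at 0 both sides are 0 by convention. *)
Lemma measurable_funV (D : set T) (f : T -> R) :
  measurable_fun D f -> measurable_fun D (fun x => (f x)^-1).
Proof.
move=> mf; rewrite (_ : (fun _ => _) = fun x => f x * (f x ^+ 2) `^ (-1)).
  apply: measurable_funM => //.
  apply: (measurableT_comp (measurable_powR _)).
  exact: measurable_funX.
apply/funext => x; rewrite powR_inv1 ?sqr_ge0//.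
have [->|fx0] := eqVneq (f x) 0; first by rewrite invr0 mul0r.
by field.
Qed.

Lemma measurable_prod (I : Type) (s : seq I) (h : I -> T -> R) (D : set T) :
  (forall i, measurable_fun D (h i)) ->
  measurable_fun D (fun x => \prod_(i <- s) h i x).
Proof.
move=> mh; elim: s => [|i s ih].
  by under eq_fun do rewrite big_nil; exact: measurable_cst.
by under eq_fun do rewrite big_cons; exact: measurable_funM.
Qed.

Definition measurable_mx n p (M : T -> 'M[R]_(n, p)) :=
  forall i j, measurable_fun setT (fun w => M w i j).

Lemma measurable_mxD n p (M N : T -> 'M[R]_(n, p)) :
  measurable_mx M -> measurable_mx N -> measurable_mx (fun w => M w + N w).
Proof.
by move=> mM mN i j; under eq_fun do rewrite mxE; exact: measurable_funD.
Qed.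

Lemma measurable_mxZ n p a (M : T -> 'M[R]_(n, p)) :
  measurable_mx M -> measurable_mx (fun w => a *: M w).
Proof.
by move=> mM i j; under eq_fun do rewrite mxE; exact: measurable_funM.
Qed.

Lemma measurable_mulmx n p q (M : T -> 'M[R]_(n, p)) (N : T -> 'M[R]_(p, q)) :
  measurable_mx M -> measurable_mx N -> measurable_mx (fun w => M w *m N w).
Proof.
move=> mM mN i j; under eq_fun do rewrite mxE.
by apply: measurable_sum => k; exact: measurable_funM.
Qed.

Lemma measurable_trmx n p (M : T -> 'M[R]_(n, p)) :
  measurable_mx M -> measurable_mx (fun w => (M w)^T).
Proof. by move=> mM i j; under eq_fun do rewrite mxE; exact: mM. Qed.

Lemma measurable_det n (M : T -> 'M[R]_n) :
  measurable_mx M -> measurable_fun setT (fun w => \det (M w)).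
Proof.
move=> mM; apply: measurable_sum => s; apply: measurable_funM => //.
by apply: measurable_prod => i; exact: mM.
Qed.

(** Cramer's formula on the measurable set where the determinant is nonzero; elsewhere [invmx M] is
    [M] itself by convention. *)
Lemma measurable_invmx n (M : T -> 'M[R]_n) :
  measurable_mx M -> measurable_mx (fun w => invmx (M w)).
Proof.
move=> mM i j; have mdet := measurable_det mM.
have mu : measurable_fun setT (fun w => M w \in unitmx).
  rewrite (_ : (fun _ => _) = fun w => ~~ (\det (M w) == 0)).
    exact/measurable_neg/measurable_fun_eqr.
  by apply/funext => w; rewrite unitmxE unitfE.
rewrite (_ : (fun _ => _) = fun w => if M w \in unitmx
    then (\det (M w))^-1 * (\adj (M w)) i j else M w i j); last first.
  by apply/funext => w; rewrite /invmx; case: ifP => // _; rewrite mxE.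
apply: measurable_fun_ifT => //; apply: measurable_funM.
  exact: measurable_funV.
under eq_fun do rewrite mxE /cofactor.
apply: measurable_funM => //; apply: measurable_det => k l.
by under eq_fun do rewrite !mxE; exact: mM.
Qed.

Lemma measurable_design n m (g : nat -> R -> R) (x : 'I_n -> T -> R) :
  (forall j, measurable_fun setT (g j)) ->
  (forall i, measurable_fun setT (x i)) ->
  measurable_mx (fun w => design m g (x ^~ w)).
Proof.
move=> mg mx i j; under eq_fun do rewrite mxE.
exact: (measurableT_comp (mg j)).
Qed.

End real_measurability.

Section derivative_within_an_interval.
Context {R : realType} (I : interval R) (a0 b0 : R).
Context (ab : a0 < b0) (Ia : a0 \in I) (Ib : b0 \in I).

(* A measurable choice of points of [I] other than [x] that tend to [x]; the
   derivative within [I] is then a limit of measurable functions of [x]. *)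
Definition approach (k : nat) (x : R) : R :=
  if x + k.+1%:R^-1 \in I then x + k.+1%:R^-1 else x - k.+1%:R^-1.


Let approach_dist k x : `|x - approach k x| = k.+1%:R^-1.
Proof.
rewrite /approach; case: ifP => _.
  by rewrite opprD addrA subrr sub0r normrN gtr0_norm.
by rewrite opprB addrC subrK gtr0_norm.
Qed.

(** If [x < b0], the right-hand points eventually lie between [x] and [b0]; otherwise [a0 < x], and
    the left-hand points eventually lie between [a0] and [x]. *)
Let approach_in x : x \in I -> \forall k \near \oo, approach k x \in I.
Proof.
move=> Ix; have [xb|bx] := ltP x b0.
  have e0 : 0 < b0 - x by rewrite subr_gt0.
  near=> k; have kb : k.+1%:R^-1 < b0 - x.
    by near: k; exact: (near_infty_natSinv_lt (PosNum e0)).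
  suff yI : x + k.+1%:R^-1 \in I by rewrite /approach yI.
  apply: (@interval_is_interval _ I x b0) => //.
  by rewrite lerDl invr_ge0 ler0n/= -lerBrDl ltW.
have e0 : 0 < x - a0 by rewrite subr_gt0 (lt_le_trans ab).
near=> k; have ka : k.+1%:R^-1 < x - a0.
  by near: k; exact: (near_infty_natSinv_lt (PosNum e0)).
rewrite /approach; case: ifP => // _.
apply: (@interval_is_interval _ I a0 x) => //.
by rewrite lerBrDr -lerBrDl ltW//= gerBl invr_ge0 ler0n.
Unshelve. all: by end_near. Qed.

Lemma approach_cvg x : x \in I ->
  approach k x @[k --> \oo] --> within [set` I] x^'.
Proof.
move=> Ix A [e /= e0 eA].
suff : \forall k \near \oo, A (approach k x) by [].
near=> k; apply: eA => /=.
- rewrite approach_dist.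
  by near: k; exact: (near_infty_natSinv_lt (PosNum e0)).
- by rewrite -subr_eq0 -normr_eq0 distrC approach_dist.
- by near: k; exact: approach_in.
Unshelve. all: by end_near. Qed.

(** Properness makes limits along this filter unique; it rests on [I] having two distinct points, as
    no point of a singleton can be approached. *)
Lemma within_dnbhs_proper x : x \in I -> ProperFilter (within [set` I] x^').
Proof.
move=> Ix; apply: Build_ProperFilter_ex => A AF.
have [k _ kA] := approach_cvg Ix AF.
by exists (approach k x); apply: kA; exact: leqnn.
Qed.

Lemma measurable_deriv_in g : measurable_fun setT g -> differentiable_on I g ->
  measurable_fun setT (deriv_in I g).
Proof.
move=> mg dg.
have mI (c : R) : measurable_fun setT (fun x : R => x + c \in I).
  apply: (measurable_fun_bool true); rewrite setTI.
  have -> : (fun x => x + c \in I) @^-1` [set true] =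
            (fun x => x + c) @^-1` [set` I] by [].
  rewrite -[X in measurable X]setTI.
  by apply: measurable_funD => //; exact: measurable_itv.
have mI0 : measurable_fun setT (fun x : R => x \in I).
  by have := mI 0; under eq_fun do rewrite addr0.
have ma k : measurable_fun setT (approach k).
  apply: measurable_fun_ifT => //; first exact: measurable_funD.
  exact: measurable_funB.
pose h k x := if x \in I then diff_quotient g x (approach k x) else 0.
apply: (measurable_fun_cvg (h := h)) => [k|x _].
  apply: measurable_fun_ifT => //; apply: measurable_funM.
    by apply: measurable_funB => //; exact: measurableT_comp.
  by apply: measurable_funV; exact: measurable_funB.
rewrite /h /deriv_in; case: ifP => Ix; last exact: cvg_cst.
apply: (cvg_comp _ _ (approach_cvg Ix)).
exact: dg.
Qed.

Lemma deriv_in_lincomb m (phi : nat -> R -> R) (a : 'I_m -> R) x :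
  (forall j, differentiable_on I (phi j)) ->
  deriv_in I (fun x => \sum_(j < m) a j * phi j x) x =
  \sum_(j < m) a j * deriv_in I (phi j) x.
Proof.
move=> dphi; rewrite /deriv_in; case: ifPn => Ix; last first.
  by rewrite big1// => j _; rewrite mulr0.
have FF := within_dnbhs_proper Ix.
apply/cvg_lim => //.
rewrite (_ : diff_quotient _ x =
    fun y => \sum_(j < m) a j * diff_quotient (phi j) x y); last first.
  apply/funext => y; rewrite /diff_quotient -sumrB mulr_suml.
  by apply: eq_bigr => j _; rewrite -mulrBr mulrA.
elim: (index_enum _) => [|j r ih].
  by rewrite big_nil; under eq_fun do rewrite big_nil; exact: cvg_cst.
rewrite big_cons; under eq_fun do rewrite big_cons.
by apply: cvgD ih; apply: cvgM; [exact: cvg_cst|exact: dphi].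
Qed.

End derivative_within_an_interval.

(** Otherwise [I] lies in a singleton, every integral over it is 0, and [phi 0] cannot have norm
    1. *)
Lemma orthonormal_nondegenerate (R : realType) (I : interval R)
    (phi : nat -> R -> R) : hilbert_basis I phi ->
  exists a b, [/\ a < b, a \in I & b \in I].
Proof.
move=> [_ on _]; apply: contrapT => nI.
have := on 0%N 0%N; rewrite eqxx /dotL2.
suff [r Ir] : exists r : R, [set` I] `<=` [set r].
  by rewrite /Rintegral (integral_Sset1 _ Ir)/= => /eqP; rewrite eq_sym oner_eq0.
have [[r Ir]|I0] := pselect (exists r, r \in I); last first.
  by exists 0 => x /= Ix; case: I0; exists x.
exists r => x /= Ix; apply/eqP; apply: contraT => xr.
case: (ltgtP r x) xr => // [rx|xr'] _.
  by case: nI; exists r, x.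
by case: nI; exists x, r.
Qed.

(** * Independence and uncorrelated noise *)

Section independence_and_integration.
Local Open Scope ereal_scope.
Context d (T : measurableType d) (R : realType) (P : probability T R).

Definition independent_pair (U V : T -> R) := forall A B : set R,
  measurable A -> measurable B ->
  P (U @^-1` A `&` V @^-1` B) = P (U @^-1` A) * P (V @^-1` B).

(** The law of [(U, V)] agrees with the product of the marginal laws on rectangles, hence
    everywhere. Tonelli gives the integrability of the product, then Fubini its integral. *)
Lemma independent_integralM (U V : {mfun T >-> R}) : independent_pair U V ->
  P.-integrable setT (EFin \o U) -> P.-integrable setT (EFin \o V) ->
  P.-integrable setT (fun w => (U w * V w)%:E) /\
  \int[P]_w (U w * V w)%:E = \int[P]_w (U w)%:E * \int[P]_w (V w)%:E.
Proof.
move=> UV iU iV.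
have mW : measurable_fun setT (fun w => (U w, V w)) by exact: measurable_fun_pair.
pose W : {mfun T >-> (R * R)%type} := mfun_Sub (mem_set mW).
pose m1 := distribution P U; pose m2 := distribution P V.
have lawE A : measurable A -> (m1 \x m2) A = distribution P W A.
  apply: product_measure_unique => B C mB mC.
  by rewrite /distribution/= /pushforward -UV.
pose h (z : R * R) := (z.1 * z.2)%:E.
have mh : measurable_fun setT h by exact/measurable_EFinP/measurable_funM.
have E1 (Z : {mfun T >-> R}) : P.-integrable setT (EFin \o Z) ->
    (distribution P Z).-integrable setT EFin.
  by move=> iZ; apply: integrable_pushforward.
have ih : (m1 \x m2).-integrable setT h.
  apply/integrable12ltyP => //.
  have mabs : measurable_fun setT (fun y : R => `|y|%:E).
    by apply/measurable_EFinP; exact: normr_measurable.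
  have inner x : \int[m2]_y `|h (x, y)| = `|x|%:E * \int[m2]_y `|y|%:E.
    rewrite -ge0_integralZl_EFin//.
    by apply: eq_integral => y _; rewrite /h/= normrM EFinM.
  have absV : \int[m2]_y `|y|%:E < +oo.
    by have /integrableP[_] := E1 _ iV.
  have absU : \int[m1]_y `|y|%:E < +oo.
    by have /integrableP[_] := E1 _ iU.
  under eq_integral do rewrite inner.
  rewrite ge0_integralZr//; last by apply: integral_ge0.
  rewrite lte_mul_pinfty//; first by apply: integral_ge0.
  by rewrite ge0_fin_numE//; apply: integral_ge0.
have ihW : (distribution P W).-integrable setT h.
  apply/integrableP; split => //; have /integrableP[_] := ih.
  by rewrite (eq_measure_integral (distribution P W)) => // A mA _; exact: lawE.
have hWE : (fun w => (U w * V w)%:E) = h \o W by [].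
have iUV : P.-integrable setT (h \o W).
  apply/integrableP; split; first exact: measurableT_comp.
  have /integrableP[_] := ihW; rewrite ge0_integral_pushforward//.
  by apply: measurableT_comp.
split => //; rewrite hWE.
transitivity (\int[distribution P W]_z h z).
  by rewrite integral_pushforward.
transitivity (\int[m1 \x m2]_z h z).
  by apply: eq_measure_integral => A mA _; apply/esym/lawE.
rewrite -integral12_prod_meas1// /fubini_F /h/=.
under eq_integral => x _ do under eq_integral => y _ do rewrite EFinM.
under eq_integral => x _ do rewrite integralZl ?E1//.
rewrite -[X in _ = X * _](integral_distribution (P := P) (X := U) (f := EFin))//.
rewrite -[X in _ = _ * X](integral_distribution (P := P) (X := V) (f := EFin))//.
have : \int[m2]_x x%:E \is a fin_num by apply: integrable_fin_num; rewrite ?E1.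
by move=> /fineK <-; rewrite integralZr ?E1.
Qed.

Lemma integrable_mul_sqr (U V : T -> R) :
  measurable_fun setT U -> measurable_fun setT V ->
  P.-integrable setT (fun w => (U w ^+ 2)%:E) ->
  P.-integrable setT (fun w => (V w ^+ 2)%:E) ->
  P.-integrable setT (fun w => (U w * V w)%:E).
Proof.
move=> mU mV iU iV; have iUV := integrableD measurableT iU iV.
apply: le_integrable iUV => //.
  exact/measurable_EFinP/measurable_funM.
move=> w _ /=; rewrite lee_fin [leRHS]ger0_norm ?addr_ge0 ?sqr_ge0//.
by rewrite ler_norml; apply/andP; split; nra.
Qed.

Lemma integrable_ae0 (h : T -> R) : measurable_fun setT h ->
  ae_eq P setT (EFin \o h) (cst 0) ->
  P.-integrable setT (EFin \o h) /\ \int[P]_w (h w)%:E = 0.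
Proof.
move=> mh h0; have mh' : measurable_fun setT (EFin \o h).
  exact/measurable_EFinP.
have ih : P.-integrable setT (EFin \o h).
  apply/integrableP; split => //.
  by move/(ae_eq_integral_abs _ measurableT mh') : h0 => ->.
by split => //; rewrite (ae_eq_integral (cst 0)) ?integral0.
Qed.

Lemma second_moment0 (e : T -> R) : measurable_fun setT e ->
  \int[P]_w (e w ^+ 2)%:E = 0 -> ae_eq P setT (EFin \o e) (cst 0).
Proof.
move=> me e0.
have : ae_eq P setT (fun w => (e w ^+ 2)%:E) (cst 0).
  apply/ae_eq_integral_abs => //.
    exact/measurable_EFinP/measurable_funX.
  by under eq_integral do rewrite gee0_abs ?lee_fin ?sqr_ge0//.
apply: filterS => w /= h _; have := h I.
by move=> [] /eqP; rewrite sqrf_eq0 => /eqP ->.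
Qed.

(* If [c k = 0] then [e k] vanishes almost surely and [Z k] may have an infinite
   second moment: the right-hand side is then read with [0 * +oo = 0]. *)
Lemma orthogonal_noise_le (K : finType) (Z e : K -> T -> R) (c : K -> R) :
  (forall k, measurable_fun setT (Z k)) ->
  (forall k, measurable_fun setT (e k)) ->
  (forall k l, independent_pair (fun w => Z k w * Z l w)%R
                                (fun w => e k w * e l w)%R) ->
  (forall k, \int[P]_w (e k w ^+ 2)%:E = (c k)%:E) ->
  (forall k l, k != l -> \int[P]_w (e k w * e l w)%:E = 0) ->
  \int[P]_w ((\sum_k Z k w * e k w) ^+ 2)%:E <=
  \sum_k (c k)%:E * \int[P]_w (Z k w ^+ 2)%:E.
Proof.
move=> mZ me ind ek2 ekl.
have Z20 k : 0 <= \int[P]_w (Z k w ^+ 2)%:E.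
  by apply: integral_ge0 => w _; rewrite lee_fin sqr_ge0.
have c0 k : (0 <= c k)%R.
  by rewrite -lee_fin -ek2; apply: integral_ge0 => w _; rewrite lee_fin sqr_ge0.
(* If some [Z k] with [c k > 0] has an infinite second moment, the right-hand side is [+oo]. *)
have [[k /andP[ck /eqP Zk]]|nk] := pselect
    (exists k, (0 < c k)%R && (\int[P]_w (Z k w ^+ 2)%:E == +oo)).
  rewrite (bigD1 k)//= Zk gt0_muley ?lte_fin// addye ?leey//.
  rewrite -ltNye (lt_le_trans (ltNyr 0))//.
  by apply: sume_ge0 => l _; rewrite mule_ge0 ?lee_fin.
have sqr_int (g : T -> R) : measurable_fun setT g ->
    \int[P]_w (g w ^+ 2)%:E < +oo -> P.-integrable setT (fun w => (g w ^+ 2)%:E).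
  move=> mg g2; apply/integrableP; split.
    exact/measurable_EFinP/measurable_funX.
  by under eq_integral do rewrite gee0_abs ?lee_fin ?sqr_ge0//.
have iZ k : (0 < c k)%R -> P.-integrable setT (fun w => (Z k w ^+ 2)%:E).
  move=> ck; apply: sqr_int => //; rewrite ltey.
  by apply/negP => Zk; apply: nk; exists k; rewrite ck.
have ie k : P.-integrable setT (fun w => (e k w ^+ 2)%:E).
  by apply: sqr_int; rewrite // ek2 ltry.
have mZZ k l : measurable_fun setT (fun w => Z k w * Z l w)%R.
  exact: measurable_funM.
have mee k l : measurable_fun setT (fun w => e k w * e l w)%R.
  exact: measurable_funM.
have null k l : c k = 0%R \/ c l = 0%R ->
    ae_eq P setT (fun w => (Z k w * Z l w * (e k w * e l w))%:E) (cst 0).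
  move=> [c'|c'].
    have : ae_eq P setT (EFin \o e k) (cst 0).
      by apply: second_moment0; rewrite // ek2 c'.
    by apply: filterS => w /= h _; have [->] := h I; rewrite mul0r mulr0.
  have : ae_eq P setT (EFin \o e l) (cst 0).
    by apply: second_moment0; rewrite // ek2 c'.
  by apply: filterS => w /= h _; have [->] := h I; rewrite !mulr0.
have mZe k l : measurable_fun setT (fun w => Z k w * Z l w * (e k w * e l w))%R.
  exact: measurable_funM.
(* The terms of the expanded square. Either a factor [e] is almost surely zero, or [Z k] and [Z l]
   are both square integrable and the expectation factors by independence. *)
have main k l :
    P.-integrable setT (fun w => (Z k w * Z l w * (e k w * e l w))%:E) /\
    \int[P]_w (Z k w * Z l w * (e k w * e l w))%:E =
      if k == l then (c k)%:E * \int[P]_w (Z k w ^+ 2)%:E else 0.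
  have [ck0|ck] := eqVneq (c k) 0%R.
    have [|h1 h2] := integrable_ae0 (mZe k l); first by apply: null; left.
    by split => //; rewrite h2 ck0 mul0e if_same.
  have [cl0|cl] := eqVneq (c l) 0%R.
    have [|h1 h2] := integrable_ae0 (mZe k l); first by apply: null; right.
    by split => //; rewrite h2; case: ifP => // /eqP ->; rewrite cl0 mul0e.
  have {}ck : (0 < c k)%R by rewrite lt_neqAle eq_sym ck c0.
  have {}cl : (0 < c l)%R by rewrite lt_neqAle eq_sym cl c0.
  have iZZ := integrable_mul_sqr (mZ k) (mZ l) (iZ _ ck) (iZ _ cl).
  have iee := integrable_mul_sqr (me k) (me l) (ie k) (ie l).
  pose U : {mfun T >-> R} := mfun_Sub (mem_set (mZZ k l)).
  pose V : {mfun T >-> R} := mfun_Sub (mem_set (mee k l)).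
  have [h1 h2] := @independent_integralM U V (ind k l) iZZ iee.
  split; [exact: h1|apply: etrans h2 _].
  change (\int[P]_w (Z k w * Z l w)%:E * \int[P]_w (e k w * e l w)%:E =
    if k == l then (c k)%:E * \int[P]_w (Z k w ^+ 2)%:E else 0).
  have [<-|kl] := eqVneq k l.
    by rewrite muleC; congr (_ * _); rewrite -?ek2; apply: eq_integral => w _;
      rewrite expr2.
  by rewrite [X in _ * X](ekl _ _ kl) mule0.
have -> : \int[P]_w ((\sum_k Z k w * e k w) ^+ 2)%:E =
    \int[P]_w (\sum_k \sum_l (Z k w * Z l w * (e k w * e l w))%:E).
  apply: eq_integral => w _; rewrite expr2 mulr_suml -sumEFin.
  apply: eq_bigr => k _; rewrite mulr_sumr -sumEFin.
  by apply: eq_bigr => l _; rewrite mulrACA.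
rewrite integral_sum//; last first.
  by move=> k; apply: integrable_sum => // l _; exact: (main k l).1.
apply: lee_sum => k _; rewrite integral_sum//; last by move=> l; exact: (main k l).1.
rewrite (bigD1 k)//= big1 ?adde0 => [|l /negPf lk].
  by rewrite (main k k).2 eqxx.
by rewrite (main k l).2 eq_sym lk.
Qed.

End independence_and_integration.


Section generated_sigma_algebra.
Local Open Scope ereal_scope.
Context d (T : measurableType d) (R : realType) (P : probability T R).

(** The generating family behind [g_sigma_preimage], so that the measurable sets of the type
    generated by it are those of [independent_vectors]. *)
Definition preimages n (W : 'I_n -> T -> R) : set (set T) :=
  \big[setU/set0]_(i < n) preimage_set_system setT (W i) measurable.

(* As a type, so that the closure properties of [measurable_fun] apply to
   measurability with respect to the sigma-algebra generated by [W]. *)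
Local Notation gen W := (g_sigma_algebraType (preimages W)).

Lemma measurable_fun_generated n (W : 'I_n -> T -> R) i :
  measurable_fun setT (W i : gen W -> R).
Proof.
move=> _ B mB; apply: sub_sigma_algebra.
by rewrite /preimages (bigD1 i)//=; left; exists B.
Qed.

Lemma preimage_generated n (W : 'I_n -> T -> R) (U : gen W -> R) B :
  measurable_fun setT U -> measurable B -> g_sigma_preimage W (U @^-1` B).
Proof. by move=> mU mB; rewrite -[_ @^-1` _]setTI; exact: mU. Qed.

Lemma measurable_fun_gen n (W : 'I_n -> {RV P >-> R}) (U : T -> R) :
  measurable_fun (setT : set (gen (fun i => W i : T -> R))) U ->
  measurable_fun (setT : set T) U.
Proof.
move=> mU _ B mB; rewrite setTI.
have : g_sigma_preimage (fun i => W i : T -> R) (U @^-1` B).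
  exact: preimage_generated mU mB.
apply: smallest_sub; first exact: sigma_algebra_measurable.
elim/big_rec: _ => [|i G _ sG]; first exact: sub0set.
by rewrite subUset; split => // _ [C mC <-]; exact: (measurable_funP (W i)).
Qed.

Lemma independent_vectors_pair n p (X : 'I_n -> {RV P >-> R})
    (W : 'I_p -> {RV P >-> R}) (U V : T -> R) :
  independent_vectors X W ->
  measurable_fun (setT : set (gen (fun i => X i : T -> R))) U ->
  measurable_fun (setT : set (gen (fun i => W i : T -> R))) V ->
  independent_pair P U V.
Proof.
by move=> XW mU mV A B mA mB; apply: XW; exact: preimage_generated.
Qed.

Lemma mutually_independent_pair n (Z : 'I_n -> {RV P >-> R}) i j :
  mutually_independent Z -> i != j -> independent_pair P (Z i) (Z j).
Proof.
move=> indZ ij A B mA mB.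
pose C k := if k == i then A else B.
have mC k : measurable (C k) by rewrite /C; case: ifP.
have := indZ [set i; j]%SET C mC.
rewrite big_setU1/= ?inE// big_set1 /C eqxx [j == i]eq_sym (negPf ij) => <-.
congr (P _); apply/seteqP; split => [w [Aw Bw] k /=|w h].
  by rewrite !inE => /orP[] /eqP ->; rewrite ?eqxx 1?eq_sym ?(negPf ij).
split.
  by have := h i; rewrite /= !inE !eqxx; apply.
by have := h j; rewrite /= !inE !eqxx orbT eq_sym (negPf ij); apply.
Qed.

Lemma second_moment (Z : {RV P >-> R}) s :
  'E_P[Z] = 0 -> 'V_P[Z] = s%:E -> \int[P]_w (Z w ^+ 2)%:E = s%:E.
Proof.
move=> EZ <-; rewrite /variance covariance.unlock EZ expectation.unlock.
by apply: eq_integral => w _; rewrite [in RHS]fctE/= subr0 expr2.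
Qed.

Lemma integrable_second_moment (Z : {RV P >-> R}) s :
  \int[P]_w (Z w ^+ 2)%:E = s%:E -> P.-integrable setT (EFin \o Z).
Proof.
move=> Z2.
have i1 : P.-integrable setT (fun _ : T => (1 ^+ 2 : R)%:E).
  by apply: finite_measure_integrable_cst.
have iZ2 : P.-integrable setT (fun w => (Z w ^+ 2)%:E).
  apply/integrableP; split; first exact/measurable_EFinP/measurable_funX.
  by under eq_integral do rewrite gee0_abs ?lee_fin ?sqr_ge0//; rewrite Z2 ltry.
have := @integrable_mul_sqr _ _ _ P Z (cst 1%R) _ _ iZ2 i1.
rewrite (_ : (fun w => _) = EFin \o Z); first exact.
by apply/funext => w; rewrite /= mulr1.
Qed.

Lemma uncorrelated n (eps : 'I_n -> {RV P >-> R}) (s : R) i j :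
  mutually_independent eps -> (forall i, 'E_P[eps i] = 0) ->
  (forall i, 'V_P[eps i] = s%:E) -> i != j ->
  \int[P]_w (eps i w * eps j w)%:E = 0.
Proof.
move=> ind E0 V ij.
have int k : P.-integrable setT (EFin \o eps k).
  by apply: integrable_second_moment; apply: second_moment.
have [_ ->] :=
  independent_integralM (mutually_independent_pair ind ij) (int i) (int j).
by rewrite -expectation_def E0 mul0e.
Qed.

End generated_sigma_algebra.

(** * Densities and best approximation in L^2 *)

Section density.
Local Open Scope ereal_scope.

(** By uniqueness, [f] is almost everywhere the Radon-Nikodym derivative of [nu], for which the
    change of variables holds; finiteness of [nu] makes [f] integrable. *)
Lemma integral_finite_measure_density d (S : measurableType d) (R : realType)
    (nu : {finite_measure set S -> \bar R})
    (mu : {sigma_finite_measure set S -> \bar R}) (f h : S -> R) :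
  measurable_fun setT f -> (forall x, (0 <= f x)%R) ->
  (forall B, measurable B -> nu B = \int[mu]_(x in B) (f x)%:E) ->
  measurable_fun setT h -> (forall x, (0 <= h x)%R) ->
  \int[nu]_x (h x)%:E = \int[mu]_x (h x * f x)%:E.
Proof.
move=> mf f0 fE mh h0.
have mf' : measurable_fun setT (EFin \o f) by exact/measurable_EFinP.
have mh' : measurable_fun setT (EFin \o h) by exact/measurable_EFinP.
have fi : mu.-integrable setT (EFin \o f).
  apply/integrableP; split => //.
  under eq_integral do rewrite /= ger0_norm//.
  by rewrite -fE// -ge0_fin_numE// fin_num_measure.
have numu : nu `<< mu.
  move=> A nA B mB BA; rewrite [LHS]fE// null_set_integral//.
    exact: measurable_funTS.
  exact: nA.
have h0' x : 0 <= (EFin \o h) x by rewrite lee_fin.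
have e := @Radon_Nikodym_SigmaFinite.change_of_variables _ _ _ nu mu numu _ setT h0'
  measurableT mh'.
rewrite -[LHS]e.
have RNi := Radon_Nikodym_SigmaFinite.f_integrable numu.
have mRN := measurable_int _ RNi.
apply: ge0_ae_eq_integral => //.
- exact: emeasurable_funM.
- by apply/measurable_EFinP; exact: measurable_funM.
- move=> x _; rewrite mule_ge0 ?lee_fin//.
  exact: Radon_Nikodym_SigmaFinite.f_ge0.
- by move=> x _; rewrite lee_fin mulr_ge0.
have : ae_eq mu setT (EFin \o f) (Radon_Nikodym_SigmaFinite.f nu mu).
  apply: integral_ae_eq => // A _ mA.
  by rewrite -Radon_Nikodym_SigmaFinite.f_integral// fE.
by apply: filterS => x /= e' _; rewrite -(e' I) EFinM.
Qed.

Lemma integral_density d (T : measurableType d) (R : realType)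
    (P : probability T R) (Z : {RV P >-> R}) (f h : R -> R) :
  has_density Z f -> measurable_fun setT h -> (forall x, (0 <= h x)%R) ->
  \int[P]_w (h (Z w))%:E = \int[lebesgue_measure]_x (h x * f x)%:E.
Proof.
move=> [mf f0 fE] mh h0.
(* [Z] is repacked so that its law and [lebesgue_measure] are measures on the same type. *)
have mZ : measurable_fun setT (Z : T -> measurableTypeR R).
  by have mZ : measurable_fun setT Z by []; exact: mZ.
pose Z' : {RV P >-> measurableTypeR R} :=
  @mfun_Sub _ _ T (measurableTypeR R) Z (mem_set mZ).
transitivity (\int[distribution P Z']_x (EFin \o h) x).
  apply/esym/ge0_integral_distribution => [|y]; first exact/measurable_EFinP.
  by rewrite lee_fin.
exact: (@integral_finite_measure_density _ _ R (distribution P Z')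
  lebesgue_measure).
Qed.

End density.

Section best_approximation.
Context {R : realType} (I : interval R).
Notation mu := (@lebesgue_measure R).

Let mI : measurable ([set` I] : set (measurableTypeR R)).
Proof. exact: measurable_itv. Qed.

Lemma inL2_integrable g : inL2 I g ->
  mu.-integrable [set` I] (fun x => (g x ^+ 2)%:E).
Proof.
move=> [mg g2]; apply/integrableP; split.
  exact/measurable_EFinP/measurable_funX.
by under eq_integral do rewrite gee0_abs ?lee_fin ?sqr_ge0//.
Qed.

Lemma inL2_mul_integrable g h : inL2 I g -> inL2 I h ->
  mu.-integrable [set` I] (fun x => (g x * h x)%:E).
Proof.
move=> g2 h2; have mg := g2.1; have mh := h2.1.
have := integrableD mI (inL2_integrable g2) (inL2_integrable h2).
apply: le_integrable => //; first exact/measurable_EFinP/measurable_funM.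
move=> x _ /=; rewrite lee_fin [leRHS]ger0_norm ?addr_ge0 ?sqr_ge0//.
by rewrite ler_norml; apply/andP; split; nra.
Qed.

Lemma inL2D g h : inL2 I g -> inL2 I h -> inL2 I (g \+ h).
Proof.
move=> g2 h2; split; first by apply: measurable_funD; [exact: g2.1|exact: h2.1].
have /integrableP[_] : mu.-integrable [set` I] (fun x => ((g x + h x) ^+ 2)%:E).
  have gg := inL2_mul_integrable g2 g2; have hh := inL2_mul_integrable h2 h2.
  have gh := inL2_mul_integrable g2 h2.
  have := integrableD mI (integrableD mI gg gh) (integrableD mI gh hh).
  by apply: eq_integrable => // x _; rewrite /= -!EFinD; congr (_%:E); ring.
by under eq_integral do rewrite gee0_abs ?lee_fin ?sqr_ge0//.
Qed.

Lemma inL2Z a g : inL2 I g -> inL2 I (fun x => a * g x).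
Proof.
move=> g2; split; first by apply: measurable_funM => //; exact: g2.1.
have /integrableP[_] : mu.-integrable [set` I] (fun x => ((a * g x) ^+ 2)%:E).
  have := integrableZl mI (a ^+ 2) (inL2_integrable g2).
  by apply: eq_integrable => // x _; rewrite /= -EFinM exprMn.
by under eq_integral do rewrite gee0_abs ?lee_fin ?sqr_ge0//.
Qed.

Lemma inL2_0 : inL2 I (fun=> 0).
Proof.
split => //; rewrite /sqnormL2.
by under eq_integral do rewrite expr0n/=; rewrite integral0.
Qed.

Lemma inL2_span phi m t : (forall j, inL2 I (phi j)) -> spanS phi m t ->
  inL2 I t.
Proof.
move=> phi2 [a ->]; elim: (index_enum _) => [|j r ih].
  by under [X in inL2 _ X]eq_fun do rewrite big_nil; exact: inL2_0.
under [X in inL2 _ X]eq_fun do rewrite big_cons.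
by apply: inL2D ih; exact: inL2Z.
Qed.

(** With [s = t - p], pointwise [(t - g)^2 = (p - g)^2 - 2 (g - p) s + s^2]. Dropping [s^2] and
    integrating suffices, since the middle term integrates to 0. *)
Lemma orthproj_best phi m g p t : (forall j, inL2 I (phi j)) -> inL2 I g ->
  is_orthproj I phi m g p -> spanS phi m t ->
  (sqnormL2 I (p \- g)%R <= sqnormL2 I (t \- g)%R)%E.
Proof.
move=> phi2 g2 [sp orth] st.
have p2 := inL2_span phi2 sp; have t2 := inL2_span phi2 st.
pose s := t \- p.
have ss : spanS phi m s.
  case: sp st => [a pE] [c tE]; exists (fun j => c j - a j).
  rewrite /s pE tE; apply/funext => x /=; rewrite -sumrB.
  by apply: eq_bigr => j _; rewrite mulrBl.
have s2 := inL2_span phi2 ss.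
have opp h : inL2 I h -> inL2 I (\- h).
  by move=> /(inL2Z (-1)); congr inL2; apply/funext => x /=; rewrite mulN1r.
have pg : inL2 I (p \- g) by apply: inL2D p2 _; exact: opp.
have gp : inL2 I (g \- p) by apply: inL2D g2 _; exact: opp.
have tg : inL2 I (t \- g) by apply: inL2D t2 _; exact: opp.
have igs := inL2_mul_integrable gp s2.
(* [dotL2] is real-valued and would also be 0 for an infinite integral; integrability makes its
   vanishing conclusive. *)
have int0 : (\int[mu]_(x in [set` I]) ((g \- p) x * s x)%:E = 0)%E.
  rewrite -[LHS]fineK; last exact: integrable_fin_num.
  by congr (_%:E); exact: orth.
have e : (\int[mu]_(x in [set` I]) (((p \- g) x ^+ 2)%:E +
    (-2)%:E * ((g \- p) x * s x)%:E) = sqnormL2 I (p \- g)%R)%E.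
  rewrite integralD//; last 2 first.
  - exact: inL2_integrable.
  - exact: integrableZl.
  by rewrite integralZl// int0 mule0 adde0.
rewrite -e; apply: le_integral => //.
- by apply: integrableD => //; [exact: inL2_integrable|exact: integrableZl].
- exact: inL2_integrable.
- move=> x _; rewrite -EFinM -EFinD lee_fin /s/= -subr_ge0.
  rewrite [leRHS](_ : _ = (t x - p x) ^+ 2) ?sqr_ge0//; ring.
Qed.

End best_approximation.

(** * The error of the estimator *)

Section error_decomposition.
Context {R : realType} (n : nat) (I : interval R) (m : nat) (phi : nat -> R -> R).

Definition hatmx (x : 'I_n -> R) : 'M[R]_n :=
  design m (fun j => deriv_in I (phi j)) x
  *m invmx ((design m phi x)^T *m design m phi x) *m (design m phi x)^T.

Definition evalc (g : R -> R) (x : 'I_n -> R) : 'cV[R]_n := \col_i g (x i).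

Definition bias (bI b'I bm b'm : R -> R) (x : 'I_n -> R) : 'cV[R]_n :=
  hatmx x *m evalc (bI \- bm) x + evalc (deriv_in I bm \- b'm) x
  + evalc (b'm \- b'I) x.

Lemma dotc_evalc g x : dotc (evalc g x) (evalc g x) = \sum_i g (x i) ^+ 2.
Proof. by apply: eq_bigr => i _; rewrite mxE expr2. Qed.

Lemma evalc_span (g : nat -> R -> R) (a : 'I_m -> R) x :
  evalc (fun u => \sum_(j < m) a j * g j u) x = design m g x *m \col_j a j.
Proof.
apply/matrixP => i j; rewrite !mxE; apply: eq_bigr => k _.
by rewrite !mxE mulrC.
Qed.

Lemma evalcB g h x : evalc (g \- h) x = evalc g x - evalc h x.
Proof. by apply/matrixP => i j; rewrite !mxE. Qed.

Lemma Psihat_unit (x : 'I_n -> R) : (0 < n)%N ->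
  (Psihat m phi x \in unitmx) = ((design m phi x)^T *m design m phi x \in unitmx).
Proof.
move=> n0; rewrite /Psihat unitmxZ// unitfE invr_eq0 pnatr_eq0 -lt0n//.
Qed.

Lemma bhat'_error (x y e : 'I_n -> R) (b bI b'I bm b'm : R -> R) i :
  (0 < n)%N -> (exists a b, [/\ a < b, a \in I & b \in I]) ->
  (forall j, differentiable_on I (phi j)) ->
  (forall j u, u \notin I -> phi j u = 0) ->
  (forall u, bI u = b u * \1_[set` I] u) ->
  spanS phi m bm -> spanS phi m b'm ->
  Psihat m phi x \in unitmx -> (forall k, y k = b (x k) + e k) ->
  bhat' I m phi x y (x i) - b'I (x i) =
  bias bI b'I bm b'm x i 0 + \sum_k hatmx x i k * e k.
Proof.
move=> n0 [a0 [b0 [ab Ia Ib]]] dphi phi_out bIE [a bmE] [a' b'mE] uPsi yE.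
have uG : (design m phi x)^T *m design m phi x \in unitmx by rewrite -Psihat_unit.
have nu : (n%:R^-1 : R) \is a GRing.unit.
  by rewrite unitfE invr_eq0 pnatr_eq0 -lt0n.
pose Phi := design m phi x.
pose Phi' := design m (fun j => deriv_in I (phi j)) x.
(* The factor [n] from inverting [Psihat] cancels the [n^-1] in [thetahat]. *)
have theta : thetahat m phi x y = invmx (Phi^T *m Phi) *m Phi^T *m \col_k y k.
  rewrite /thetahat /Psihat -/Phi invmxZ// -!scalemxAl scalerA divrr ?scale1r//.
have YE : Phi^T *m \col_k y k = Phi^T *m (evalc bI x + \col_k e k).
  apply/matrixP => j l; rewrite !mxE; apply: eq_bigr => k _; rewrite !mxE.
  have [Ik|Ik] := boolP (x k \in I); last by rewrite phi_out// !mul0r.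
  by rewrite yE bIE indicE mem_set//= mulr1.
have bmx : evalc bm x = Phi *m \col_j a j by rewrite bmE evalc_span.
have b'mx : evalc b'm x = Phi *m \col_j a' j by rewrite b'mE evalc_span.
have dbmx : evalc (deriv_in I bm) x = Phi' *m \col_j a j.
  rewrite -evalc_span bmE; congr evalc; apply/funext => u.
  exact: (deriv_in_lincomb ab Ia Ib).
have := @fitted_decomposition _ _ _ Phi Phi' (\col_k y k) (\col_k e k)
  (evalc bI x) (evalc b'I x) (\col_j a j) (\col_j a' j) uG YE.
rewrite -theta -bmx -b'mx -dbmx -!evalcB => /matrixP/(_ i 0).
rewrite [in LHS]mxE [X in _ + X]mxE [X in _ - X]mxE => h.
rewrite [RHS]mxE in h.
transitivity ((Phi' *m thetahat m phi x y) i 0 - b'I (x i)).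
  congr (_ - _); rewrite /bhat' mxE; apply: eq_bigr => j _.
  by rewrite !mxE mulrC.
rewrite h; congr (_ + _); rewrite [LHS]mxE.
by apply: eq_bigr => k _; rewrite [X in _ * X]mxE.
Qed.

(** Coordinatewise, the gap is [(u - v)^2 + (u - w)^2 + (v - w)^2]. *)
Lemma dotc_add3_le p (u v w : 'cV[R]_p) :
  dotc (u + v + w) (u + v + w) <=
  3 * dotc u u + 3 * dotc v v + 3 * dotc w w.
Proof.
rewrite /dotc !mulr_sumr -!big_split ler_sum// => i _; rewrite !mxE.
have := sqr_ge0 (u i 0 - v i 0); have := sqr_ge0 (u i 0 - w i 0).
by have := sqr_ge0 (v i 0 - w i 0); rewrite /=; nra.
Qed.

End error_decomposition.

(** * Integrals: signal plus noise, empirical norms and bounded densities *)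

Section integration_lemmas.
Local Open Scope ereal_scope.

Import HBNNSimple.

(* The integral of a nonnegative function is a supremum over the simple
   functions below it, so that no measurability is needed here. *)
Lemma le_integral_nonmeasurable d (T : measurableType d) (R : realType)
    (mu : {measure set T -> \bar R}) (f g : T -> \bar R) :
  (forall x, 0 <= f x) -> (forall x, f x <= g x) ->
  \int[mu]_x f x <= \int[mu]_x g x.
Proof.
move=> f0 fg; have g0 x : 0 <= g x by exact: le_trans (fg x).
rewrite !ge0_integralE//; apply: ereal_sup_le => _ [h hf <-].
exists h => // x; apply: le_trans (hf x) _.
by rewrite !patch_setT fg.
Qed.

(** Row by row an instance of [orthogonal_noise_le]. Measurability of [v] and [M] for the
    sigma-algebra of [X] makes their products independent of those of the noise. *)
Lemma sum_signal_noise_le d (T : measurableType d) (R : realType)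
    (P : probability T R) n p (sigma : R)
    (X : 'I_n -> {RV P >-> R}) (eps : 'I_p -> {RV P >-> R}) q
    (v : T -> 'cV[R]_q) (M : T -> 'M[R]_(q, p)) :
  mutually_independent eps -> (forall i, 'E_P[eps i] = 0) ->
  (forall i, 'V_P[eps i] = (sigma ^+ 2)%:E) -> independent_vectors X eps ->
  measurable_mx (v : g_sigma_algebraType (preimages (fun i => X i : T -> R)) -> _) ->
  measurable_mx (M : g_sigma_algebraType (preimages (fun i => X i : T -> R)) -> _) ->
  \int[P]_w (\sum_i (v w i 0 + \sum_k M w i k * eps k w) ^+ 2)%:E <=
  \int[P]_w (dotc (v w) (v w))%:E +
  (sigma ^+ 2)%:E * \int[P]_w (\sum_i \sum_k M w i k ^+ 2)%:E.
Proof.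
move=> ieps E0 V iXe mv mM.
have mv' i : measurable_fun setT (fun w => v w i 0%R).
  exact: measurable_fun_gen (mv i 0%R).
have mM' i k : measurable_fun setT (fun w => M w i k).
  exact: measurable_fun_gen (mM i k).
have mN i : measurable_fun setT (fun w => v w i 0 + \sum_k M w i k * eps k w)%R.
  apply: measurable_funD => //; apply: measurable_sum => k.
  exact: measurable_funM.
(* The signal is the coefficient of an additional "noise" equal to [1]. *)
pose Z i (k : 'I_p.+1) w := if unlift ord0 k is Some k' then M w i k' else v w i 0%R.
pose e (k : 'I_p.+1) w := if unlift ord0 k is Some k' then eps k' w else 1%R.
pose c (k : 'I_p.+1) := if unlift ord0 k is Some k' then (sigma ^+ 2)%R else 1%R.
have mZ i k : measurable_fun
    (setT : set (g_sigma_algebraType (preimages (fun i => X i : T -> R)))) (Z i k).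
  by rewrite /Z; case: unlift.
have me k : measurable_fun
    (setT : set (g_sigma_algebraType (preimages (fun i => eps i : T -> R)))) (e k).
  rewrite /e; case: unlift => // k'.
  exact: (measurable_fun_generated (W := fun i : 'I_p => eps i : T -> R) k').
have noise i : \int[P]_w ((v w i 0 + \sum_k M w i k * eps k w) ^+ 2)%:E <=
    \int[P]_w (v w i 0 ^+ 2)%:E +
    \sum_k (sigma ^+ 2)%:E * \int[P]_w (M w i k ^+ 2)%:E.
  have -> : (fun w => ((v w i 0 + \sum_k M w i k * eps k w) ^+ 2)%:E) =
      (fun w => ((\sum_k Z i k w * e k w) ^+ 2)%:E).
    apply/funext => w; rewrite big_ord_recl /Z /e unlift_none mulr1.
    by congr ((_ + _) ^+ 2)%:E; apply: eq_bigr => k _; rewrite liftK.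
  have -> : \int[P]_w (v w i 0 ^+ 2)%:E +
      \sum_k (sigma ^+ 2)%:E * \int[P]_w (M w i k ^+ 2)%:E =
      \sum_k (c k)%:E * \int[P]_w (Z i k w ^+ 2)%:E.
    rewrite big_ord_recl /c /Z unlift_none mul1e; congr (_ + _).
    by apply: eq_bigr => k _; rewrite liftK.
  apply: orthogonal_noise_le => [k|k|k l|k|k l kl].
  - exact: measurable_fun_gen (mZ i k).
  - exact: measurable_fun_gen (me k).
  - by apply: independent_vectors_pair iXe _ _; exact: measurable_funM.
  - rewrite /e /c; case: unlift => [k'|]; first exact: second_moment.
    under eq_integral do rewrite expr1n.
    by have := expectation_cst P 1; rewrite unlock.
  (* Against the constant coordinate, the mixed moment is the mean of some [eps], hence 0. *)
  - rewrite /e; case: unliftP kl => [k'|] ->; case: unliftP => [l'|] -> //.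
    + by rewrite (inj_eq lift_inj); exact: uncorrelated.
    + by move=> _; under eq_integral do rewrite mulr1; rewrite -expectation_def.
    + by move=> _; under eq_integral do rewrite mul1r; rewrite -expectation_def.
have sumE (q' : nat) (g : 'I_q' -> T -> R) : (forall i, measurable_fun setT (g i)) ->
    \int[P]_w (\sum_i g i w ^+ 2)%:E = \sum_i \int[P]_w (g i w ^+ 2)%:E.
  move=> mg; under eq_integral do rewrite -sumEFin.
  rewrite ge0_integral_sum// => i; first exact/measurable_EFinP/measurable_funX.
  by move=> w _; rewrite lee_fin sqr_ge0.
rewrite sumE//.
have -> : \int[P]_w (dotc (v w) (v w))%:E = \sum_i \int[P]_w (v w i 0 ^+ 2)%:E.
  by rewrite -sumE//.
have -> : \int[P]_w (\sum_i \sum_k M w i k ^+ 2)%:E =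
    \sum_i \sum_k \int[P]_w (M w i k ^+ 2)%:E.
  under eq_integral do rewrite -sumEFin.
  rewrite ge0_integral_sum//.
  - by apply: eq_bigr => i _; rewrite sumE.
  - move=> i; apply/measurable_EFinP; apply: measurable_sum => k.
    exact: measurable_funX.
  - by move=> i w _; rewrite lee_fin; apply: sumr_ge0 => k _; exact: sqr_ge0.
rewrite ge0_sume_distrr => [|i _]; last first.
  by apply: sume_ge0 => k _; apply: integral_ge0 => w _; rewrite lee_fin sqr_ge0.
rewrite -big_split; apply: lee_sum => i _; apply: le_trans (noise i) _.
rewrite /= leeD2l// ge0_sume_distrr// => k _.
by apply: integral_ge0 => w _; rewrite lee_fin sqr_ge0.
Qed.

Lemma expectation_sqnorm_emp d (T : measurableType d) (R : realType)
    (P : probability T R) n (X : 'I_n -> {RV P >-> R}) (f h : R -> R)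
    (I : interval R) : (0 < n)%N ->
  (forall i, has_density (X i) f) -> measurable_fun setT h ->
  (forall x, x \notin I -> h x = 0%R) ->
  \int[P]_w (sqnorm_emp (fun i => X i w) h)%:E = sqnormL2w I f h.
Proof.
move=> n0 Xf mh hI.
have mh2 : measurable_fun setT (fun x => h x ^+ 2)%R by exact: measurable_funX.
have mhX i : measurable_fun setT (fun w => h (X i w) ^+ 2)%R.
  exact: (measurableT_comp mh2).
have E i : \int[P]_w (h (X i w) ^+ 2)%:E = sqnormL2w I f h.
  rewrite (integral_density (Xf i) mh2); last by move=> x; exact: sqr_ge0.
  rewrite /sqnormL2w [RHS]integral_mkcond; apply: eq_integral => x _.
  rewrite patchE; case: ifPn => // /negP xI.
  rewrite hI ?expr0n ?mul0r//; apply/negP => xI'; apply: xI.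
  by rewrite inE.
under eq_integral do rewrite /sqnorm_emp EFinM.
rewrite ge0_integralZl_EFin//; last first.
  by apply/measurable_EFinP; exact: measurable_sum.
- by move=> w _; rewrite lee_fin; apply: sumr_ge0 => i _; exact: sqr_ge0.
under eq_integral do rewrite -sumEFin.
rewrite ge0_integral_sum//; last first.
- by move=> i w _; rewrite lee_fin sqr_ge0.
- by move=> i; exact/measurable_EFinP.
under eq_bigr do rewrite E.
have -> k (S : \bar R) : \sum_(i < k) S = k%:R%:E * S.
  elim: k => [|k ih]; first by rewrite big_ord0 mul0e.
  by rewrite big_ord_recr ih -natr1 EFinD ge0_muleDl ?lee_fin ?ler01// mul1e.
by rewrite muleA -EFinM mulVf ?mul1e// pnatr_eq0 -lt0n.
Qed.

(** Nonnegativity secures distributivity in [\bar R]. It serves with [c = n^-1], [r = 3] and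
    [s = sigma^2]. *)
Lemma ge0_mule_combination (R : realType) (c r s : R) (x y z t : \bar R) :
  (0 <= r)%R -> (0 <= s)%R -> 0 <= x -> 0 <= y -> 0 <= z -> 0 <= t ->
  c%:E * (r%:E * x + r%:E * y + r%:E * z + s%:E * t) =
  r%:E * (c%:E * x) + r%:E * (c%:E * y) + r%:E * (c%:E * z) + (s * c)%:E * t.
Proof.
move=> r0 s0 x0 y0 z0 t0.
have P u : 0 <= u -> 0 <= r%:E * u by move=> u0; rewrite mule_ge0.
rewrite ge0_muleDr; last exact: mule_ge0; last by rewrite !adde_ge0 ?P.
rewrite ge0_muleDr; last exact: P; last by rewrite adde_ge0 ?P.
rewrite ge0_muleDr; last exact: P; last exact: P.
by rewrite !(muleCA c%:E r%:E) EFinM -muleA (muleCA c%:E s%:E).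
Qed.

Lemma le_sup_bounded (R : realType) (A : set R) (f : R -> R) x :
  [bounded f y | y in A] -> A x -> (f x <= sup (f @` A))%R.
Proof.
move=> [M [_ fM]] Ax; apply: ub_le_sup; last by exists x.
(* [[bounded _ | _ in _]] gives a bound by every number strictly above [M], hence [M + 1]. *)
exists (M + 1)%R => _ [y Ay <-].
by rewrite (le_trans (ler_norm _))//; apply: fM; rewrite ?ltrDl.
Qed.

Lemma sqnormL2w_le_sup (R : realType) (I : interval R) (f h : R -> R) :
  (exists x, x \in I) -> measurable_fun [set` I] f ->
  (forall x, (0 <= f x)%R) -> [bounded f x | x in [set` I]] ->
  measurable_fun [set` I] h ->
  sqnormL2w I f h <= (sup (f @` [set` I]))%:E * sqnormL2 I h.
Proof.
move=> [x0 Ix0] mf f0 fb mh.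
have fsup x : x \in I -> (f x <= sup (f @` [set` I]))%R.
  exact: le_sup_bounded.
have s0 : (0 <= sup (f @` [set` I]))%R := le_trans (f0 x0) (fsup x0 Ix0).
have mI : measurable ([set` I] : set (measurableTypeR R)).
  exact: measurable_itv.
rewrite /sqnormL2 -ge0_integralZl_EFin//; last first.
  by apply/measurable_EFinP; exact: measurable_funX.
- by move=> x _; rewrite lee_fin sqr_ge0.
apply: ge0_le_integral => //.
- by move=> x _; rewrite lee_fin mulr_ge0// sqr_ge0.
- by apply/measurable_EFinP; apply: measurable_funM => //; exact: measurable_funX.
- apply/measurable_EFinP; apply: measurable_funM => //.
  exact: measurable_funX.
- by move=> x Ix; rewrite -EFinM lee_fin mulrC ler_wpM2r ?sqr_ge0// fsup.
Qed.

End integration_lemmas.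

(** * Measurability of the estimator and of its error *)

Section measurability_of_the_estimator.
Context d (T : measurableType d) (R : realType).

Lemma measurable_evalc n (g : R -> R) (x : 'I_n -> T -> R) :
  measurable_fun setT g -> (forall i, measurable_fun setT (x i)) ->
  measurable_mx (fun w => evalc g (x ^~ w)).
Proof.
by move=> mg mx i j; under eq_fun do rewrite mxE; exact: (measurableT_comp mg).
Qed.

Context (n m : nat) (I : interval R) (phi : nat -> R -> R).
Context (x : 'I_n -> T -> R).
Context (mphi : forall j, measurable_fun setT (phi j)).
Context (mdphi : forall j, measurable_fun setT (deriv_in I (phi j))).
Context (mx : forall i, measurable_fun setT (x i)).

(** The sigma-algebra on [T] is arbitrary: the original one serves for integration, the one
    generated by [X] for independence. *)
Lemma measurable_hatmx : measurable_mx (fun w => hatmx I m phi (x ^~ w)).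
Proof.
have mD := measurable_design mphi mx (m := m).
apply: measurable_mulmx; last exact: measurable_trmx.
apply: measurable_mulmx; first exact: measurable_design.
by apply: measurable_invmx; apply: measurable_mulmx => //; exact: measurable_trmx.
Qed.

Lemma measurable_bias (bI b'I bm b'm : R -> R) :
  measurable_fun setT bI -> measurable_fun setT b'I ->
  measurable_fun setT bm -> measurable_fun setT b'm ->
  measurable_fun setT (deriv_in I bm) ->
  measurable_mx (fun w => bias I m phi bI b'I bm b'm (x ^~ w)).
Proof.
move=> mbI mb'I mbm mb'm mdbm.
apply: measurable_mxD; last by apply: measurable_evalc => //; exact: measurable_funB.
apply: measurable_mxD; last by apply: measurable_evalc => //; exact: measurable_funB.
apply: measurable_mulmx; first exact: measurable_hatmx.
by apply: measurable_evalc => //; exact: measurable_funB.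
Qed.

Lemma measurable_bhat' (y : 'I_n -> T -> R) i :
  (forall i, measurable_fun setT (y i)) ->
  measurable_fun setT (fun w => bhat' I m phi (x ^~ w) (y ^~ w) (x i w)).
Proof.
move=> my; have mD := measurable_design mphi mx (m := m).
apply: measurable_sum => j; apply: measurable_funM; last first.
  exact: (measurableT_comp (mdphi j)).
suff mt : measurable_mx (fun w => thetahat m phi (x ^~ w) (y ^~ w)) by exact: mt.
apply: measurable_mxZ; apply: measurable_mulmx; last first.
  by move=> k l; under eq_fun do rewrite mxE; exact: my.
apply: measurable_mulmx; last exact: measurable_trmx.
apply: measurable_invmx; apply: measurable_mxZ; apply: measurable_mulmx => //.
exact: measurable_trmx.
Qed.

End measurability_of_the_estimator.

Lemma measurable_zero_outside (R : realType) (I : interval R) (g h : R -> R) :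
  measurable_fun [set` I] g -> (forall x, x \in I -> h x = g x) ->
  (forall x, x \notin I -> h x = 0) -> measurable_fun setT h.
Proof.
move=> mg hg h0; rewrite (_ : h = g \_ [set` I]).
  by apply/(measurable_restrictT _ (measurable_itv I)).
apply/funext => x; rewrite patchE.
case: ifPn => [/set_mem/hg//|/negP xI]; rewrite h0//.
by apply/negP => Ix; apply: xI; exact/mem_set.
Qed.

(** * Assembly of the risk bound *)

Theorem proposition3p2 (R : realType) (d : measure_display)
    (T : measurableType d) (P : probability T R)
    (n : nat) (n_gt0 : (0 < n)%N)
    (b f : R -> R) (sigma : R)
    (X eps : 'I_n -> {RV P >-> R}) (Y : 'I_n -> T -> R)
    (b_derivable : forall x, derivable b x 1)
    (b'_continuous : continuous (derive1 b))
    (Y_def : forall i w, Y i w = b (X i w) + eps i w)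
    (X_indep : mutually_independent X)
    (X_density : forall i, has_density (X i) f)
    (eps_indep : mutually_independent eps)
    (eps_id : identically_distributed eps)
    (eps_centered : forall i, ('E_P[eps i] = 0)%E)
    (eps_variance : forall i, ('V_P[eps i] = (sigma ^+ 2)%:E)%E)
    (X_eps_indep : independent_vectors X eps)
    (I : interval R) (phi : nat -> R -> R)
    (phi_basis : hilbert_basis I phi)
    (phi_differentiable : forall j, differentiable_on I (phi j))
    (phi_out : forall j x, x \notin I -> phi j x = 0)
    (b_inL2 : inL2 I b) (b'_inL2 : inL2 I (derive1 b))
    (m : nat) (m_gt0 : (0 < m)%N)
    (Psi_invertible :
       {ae P, forall w, Psihat m phi (fun i => X i w) \in unitmx})
    (f_bounded : [bounded f x | x in [set` I]])
    (* bI and b'I are b and b' times the indicator of I; bm is the projection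
       of b, and b'm that of b' *)
    (bI b'I bm b'm : R -> R)
    (bI_def : forall x, bI x = b x * \1_[set` I] x)
    (b'I_def : forall x, b'I x = derive1 b x * \1_[set` I] x)
    (bm_proj : is_orthproj I phi m bI bm)
    (b'm_proj : is_orthproj I phi m b'I b'm) :
  let xs w := fun i => X i w in
  let ys w := fun i => Y i w in
  let Phi w := design m phi (xs w) in
  let Phi' w := design m (fun j => deriv_in I (phi j)) (xs w) in
  ('E_P[fun w => sqnorm_emp (xs w) (bhat' I m phi (xs w) (ys w) \- b'I)%R]
   <= 3%:E * (sup (f @` [set` I]))%:E
        * ereal_inf [set sqnormL2 I (t \- b'I)%R | t in spanS phi m]
      + 3%:E * 'E_P[fun w =>
          (sqopnorm (Phi' w *m invmx ((Phi w)^T *m Phi w) *m (Phi w)^T)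
           * sqnorm_emp (xs w) (bI \- bm)%R)%R]
      + 3%:E * sqnormL2w I f (deriv_in I bm \- b'm)%R
      + (sigma ^+ 2 / n%:R)%:E
        * 'E_P[fun w =>
            (\tr (invmx ((Phi w)^T *m Phi w) *m ((Phi' w)^T *m Phi' w)))%R])%E.
Proof.
cbv zeta; pose xs w := fun i => X i w; pose ys w := fun i => Y i w.
case: (phi_basis) => phi2 _ _.
have hne := orthonormal_nondegenerate phi_basis.
have [a0 [b0 [ab Ia Ib]]] := hne.
have Ine : exists x, x \in I by exists a0.
have mI : measurable ([set` I] : set (measurableTypeR R)).
  exact: measurable_itv.
have mf : measurable_fun setT f by case: (X_density (Ordinal n_gt0)).
have f0 x : 0 <= f x by case: (X_density (Ordinal n_gt0)) => _ + _; apply.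
have mphi j : measurable_fun setT (phi j).
  by apply: (measurable_zero_outside (phi2 j).1) => // x; exact: phi_out.
have mdphi j : measurable_fun setT (deriv_in I (phi j)).
  exact: (measurable_deriv_in ab Ia Ib).
have mb : measurable_fun setT b.
  apply: continuous_measurable_fun => x.
  exact/differentiable_continuous/derivable1_diffP.
have bIin x : x \in I -> bI x = b x.
  by move=> Ix; rewrite bI_def indicE mem_set// mulr1.
have bIout x : x \notin I -> bI x = 0.
  by move=> /negP Ix; rewrite bI_def indicE memNset// mulr0.
have b'Iin x : x \in I -> b'I x = derive1 b x.
  by move=> Ix; rewrite b'I_def indicE mem_set// mulr1.
have b'Iout x : x \notin I -> b'I x = 0.
  by move=> /negP Ix; rewrite b'I_def indicE memNset// mulr0.
have mbI : measurable_fun setT bI by exact: measurable_zero_outside b_inL2.1 _ _.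
have mb'I : measurable_fun setT b'I.
  exact: measurable_zero_outside b'_inL2.1 _ _.
have b'I2 : inL2 I b'I.
  split; first exact: measurable_funTS.
  have [_] := b'_inL2; apply: le_lt_trans; rewrite /sqnormL2 le_eqVlt.
  apply/orP; left; apply/eqP; apply: eq_integral => x.
  by rewrite inE => /b'Iin ->.
have [sbm _] := bm_proj; have [sb'm _] := b'm_proj.
have mspan t : spanS phi m t -> measurable_fun setT t.
  by move=> [a ->]; apply: measurable_sum => j; exact: measurable_funM.
have spanout t : spanS phi m t -> forall x, x \notin I -> t x = 0.
  by move=> [a ->] x Ix; rewrite big1// => j _; rewrite phi_out// mulr0.
have mbm := mspan _ sbm; have mb'm := mspan _ sb'm.
have mdbm : measurable_fun setT (deriv_in I bm).
  have [a bmE] := sbm.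
  rewrite (_ : deriv_in I bm = fun x => \sum_(j < m) a j * deriv_in I (phi j) x).
    by apply: measurable_sum => j; exact: measurable_funM.
  by apply/funext => x; rewrite bmE (deriv_in_lincomb ab Ia Ib).
pose H w := hatmx I m phi (xs w).
pose B w := bias I m phi bI b'I bm b'm (xs w).
have mH : measurable_mx H by exact: measurable_hatmx.
have mB : measurable_mx B by exact: measurable_bias.
have mHX : measurable_mx
    (H : g_sigma_algebraType (preimages (fun i => X i : T -> R)) -> _).
  by apply: measurable_hatmx => // i; exact: measurable_fun_generated.
have mBX : measurable_mx
    (B : g_sigma_algebraType (preimages (fun i => X i : T -> R)) -> _).
  by apply: measurable_bias => // i; exact: measurable_fun_generated.
have ninv0 : 0 <= (n%:R^-1 : R) by rewrite invr_ge0.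
(* The error formula is known only where [Psihat] is invertible; the two measurable integrands agree
   almost surely. *)
have LHSE : ('E_P[fun w => sqnorm_emp (xs w) (bhat' I m phi (xs w) (ys w) \- b'I)%R]
    = n%:R^-1%:E *
      \int[P]_w (\sum_i (B w i 0 + \sum_k H w i k * eps k w) ^+ 2)%:E)%E.
  have mS : measurable_fun setT
      (fun w => \sum_i (B w i 0 + \sum_k H w i k * eps k w) ^+ 2).
    apply: measurable_sum => i; apply: measurable_funX; apply: measurable_funD => //.
    by apply: measurable_sum => k; exact: measurable_funM.
  rewrite expectation.unlock -ge0_integralZl_EFin//; last exact/measurable_EFinP.
  - apply: ge0_ae_eq_integral => //.
    + apply/measurable_EFinP; apply: measurable_funM => //.
      apply: measurable_sum => i; apply: measurable_funX; apply: measurable_funB.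
        apply: measurable_bhat' => // k.
        rewrite (_ : Y k = (b \o X k) \+ eps k); last first.
          by apply/funext => w; exact: Y_def.
        by apply: measurable_funD => //; exact: measurableT_comp.
      exact: (measurableT_comp mb'I).
    + exact/measurable_EFinP/measurable_funM.
    + move=> w _; rewrite lee_fin mulr_ge0//.
      by apply: sumr_ge0 => i _; exact: sqr_ge0.
    + move=> w _; rewrite mule_ge0 ?lee_fin//.
      by apply: sumr_ge0 => i _; exact: sqr_ge0.
    + apply: filterS Psi_invertible => w uPsi _.
      rewrite -EFinM; congr (_ * _)%:E; apply: eq_bigr => i _; congr (_ ^+ 2).
      by apply: (bhat'_error (e := eps ^~ w) (b := b)) => // k; exact: Y_def.
  - by move=> w _; rewrite lee_fin; apply: sumr_ge0 => i _; exact: sqr_ge0.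

have sqr_ge0E (g : 'cV[R]_n) : (0 <= (dotc g g)%:E)%E by rewrite lee_fin dotc_ge0.
have mdot (g : T -> 'cV[R]_n) : measurable_mx g ->
    measurable_fun setT (fun w => (dotc (g w) (g w))%:E).
  move=> mg; apply/measurable_EFinP; apply: measurable_sum => i.
  exact: measurable_funM.
have emp (g : R -> R) : measurable_fun setT g -> (forall x, x \notin I -> g x = 0) ->
    (n%:R^-1%:E * \int[P]_w (dotc (evalc g (xs w)) (evalc g (xs w)))%:E =
     sqnormL2w I f g)%E.
  move=> mg g0; rewrite -(expectation_sqnorm_emp n_gt0 X_density mg g0).
  rewrite -ge0_integralZl_EFin//.
  - by apply: eq_integral => w _; rewrite dotc_evalc.
  - by apply: mdot; exact: measurable_evalc.
have [mu mdm mbi] : [/\ measurable_fun setT (bI \- bm),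
    measurable_fun setT (deriv_in I bm \- b'm) &
    measurable_fun setT (b'm \- b'I)].
  by split; exact: measurable_funB.
pose u w : 'cV[R]_n := H w *m evalc (bI \- bm) (xs w).
have mevalc (g : R -> R) : measurable_fun setT g ->
    measurable_mx (fun w => evalc g (xs w)).
  by move=> mg; exact: measurable_evalc.
have mHu : measurable_mx u by apply: measurable_mulmx => //; exact: mevalc.
have bias_le : (\int[P]_w (dotc (B w) (B w))%:E <=
    3%:E * \int[P]_w (dotc (u w) (u w))%:E +
    3%:E * \int[P]_w (dotc (evalc (deriv_in I bm \- b'm) (xs w))
                           (evalc (deriv_in I bm \- b'm) (xs w)))%:E +
    3%:E * \int[P]_w (dotc (evalc (b'm \- b'I) (xs w))
                           (evalc (b'm \- b'I) (xs w)))%:E)%E.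
  have m1 := mdot _ mHu; have m2 := mdot _ (mevalc _ mdm).
  have m3 := mdot _ (mevalc _ mbi).
  have mul3 (g : T -> \bar R) : measurable_fun setT g ->
      measurable_fun setT (fun w => 3%:E * g w)%E.
    by move=> mg; exact: emeasurable_funM.
  rewrite -!ge0_integralZl_EFin// -!ge0_integralD//.
  all: try by exact: mul3.
  all: try by move=> w _; rewrite ?adde_ge0 ?mule_ge0.
  all: try by apply: emeasurable_funD; exact: mul3.
  apply: ge0_le_integral => //.
  - exact: mdot.
  - by do !apply: emeasurable_funD; exact: mul3.
  - by move=> w _; rewrite -!EFinM -!EFinD lee_fin; exact: dotc_add3_le.
have noise := sum_signal_noise_le eps_indep eps_centered eps_variance
  X_eps_indep mBX mHX.
have opn : (n%:R^-1%:E * \int[P]_w (dotc (u w) (u w))%:E <=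
    'E_P[fun w => (sqopnorm (H w) * sqnorm_emp (xs w) (bI \- bm))%R])%E.
  rewrite -ge0_integralZl_EFin//; last exact: mdot.
  (* No measurability of [sqopnorm (H w)] in [w] has been established. *)
  rewrite expectation.unlock; apply: le_integral_nonmeasurable => w.
    by rewrite mule_ge0.
  rewrite -EFinM lee_fin /sqnorm_emp mulrCA ler_wpM2l// -dotc_evalc.
  exact: sqopnormP.
have trE : (\int[P]_w (\sum_i \sum_k H w i k ^+ 2)%:E = 'E_P[fun w =>
    (\tr (invmx ((design m phi (xs w))^T *m design m phi (xs w)) *m
      ((design m (fun j => deriv_in I (phi j)) (xs w))^T *m
        design m (fun j => deriv_in I (phi j)) (xs w))))%R])%E.
  have mPhi : measurable_mx (fun w => design m phi (xs w)).
    exact: measurable_design.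
  have mPhi' : measurable_mx
      (fun w => design m (fun j => deriv_in I (phi j)) (xs w)).
    exact: measurable_design.
  rewrite expectation.unlock; apply: ae_eq_integral => //.
  - apply/measurable_EFinP; apply: measurable_sum => i.
    by apply: measurable_sum => k; exact: measurable_funX.
  - apply/measurable_EFinP; apply: measurable_sum => i.
    apply: measurable_mulmx; last first.
      by apply: measurable_mulmx => //; exact: measurable_trmx.
    apply: measurable_invmx; apply: measurable_mulmx => //.
    exact: measurable_trmx.
  - apply: filterS Psi_invertible => w uPsi _; congr (_%:E).
    by apply: sum_sqr_trace; rewrite -Psihat_unit.
have approx : (sqnormL2w I f (b'm \- b'I)%R <= (sup (f @` [set` I]))%:E *
    ereal_inf [set sqnormL2 I (t \- b'I)%R | t in spanS phi m])%E.
  apply: le_trans (sqnormL2w_le_sup Ine _ f0 f_bounded _) _.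
  - exact: measurable_funTS.
  - exact: measurable_funTS.
  rewrite lee_wpmul2l ?lee_fin//.
    by rewrite (le_trans (f0 a0))//; exact: le_sup_bounded.
  (* The unweighted distance from [b'm] to [b'I] is a lower bound of all the distances in the
     infimum. *)
  apply: le_ereal_inf_tmp => _ [t st <-].
  exact: (orthproj_best phi2 b'I2 b'm_proj).
have int0 (g : T -> 'cV[R]_n) : (0 <= \int[P]_w (dotc (g w) (g w))%:E)%E.
  by apply: integral_ge0 => w _.
have H0 : (0 <= \int[P]_w (\sum_i \sum_k H w i k ^+ 2)%:E)%E.
  apply: integral_ge0 => w _; rewrite lee_fin.
  by apply: sumr_ge0 => i _; apply: sumr_ge0 => k _; exact: sqr_ge0.
rewrite [leLHS]LHSE.
apply: le_trans (lee_wpmul2l _ (le_trans noise (leeD2r _ bias_le))) _.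
  by rewrite lee_fin.
rewrite ge0_mule_combination ?sqr_ge0 ?int0//.
rewrite (emp _ mdm); last first.
  by move=> x Ix; rewrite /= (spanout b'm)// subr0 /deriv_in (negPf Ix).
rewrite (emp _ mbi); last first.
  by move=> x Ix; rewrite /= b'Iout// (spanout b'm)// subrr.
(* The approximation term, last in [bias_le], is moved to the front to match the statement. *)
rewrite trE [X in (X + _ <= _)%E]addeC addeA.
rewrite leeD2r// leeD2r// leeD//.
- by rewrite -muleA lee_wpmul2l ?lee_fin.
- by rewrite lee_wpmul2l ?lee_fin.
Qed.
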